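(* Up to isomorphism there are exactly two $1$-dimensional associative algebras over $\mathbb{C}$, namely, with basis $\{e_1\}$: $\mathcal{A}_1$ with product $e_1\cdot e_1=0$, and $\mathcal{A}_2$ with product $e_1\cdot e_1=e_1$; these two are not isomorphic. The solutions $r\in\mathcal{A}\otimes\mathcal{A}$ of the associative Yang-Baxter equation in these algebras are the following: (1) for $\mathcal{A}=\mathcal{A}_1$, the solutions are exactly the elements $r=a_{11}\,e_1\otimes e_1$ with $a_{11}\in\mathbb{C}$ arbitrary; (2) for $\mathcal{A}=\mathcal{A}_2$, the only solution is $r=0$.
   Context: All vector spaces, algebras and parameters are over the complex field $\mathbb{C}$; associative algebras are not required to be unital. For an associative algebra $(\mathcal{A},\cdot)$ and $r=\sum_i x_i\otimes y_i\in\mathcal{A}\otimes\mathcal{A}$, the associative Yang-Baxter equation (AYBE) in $\mathcal{A}$ is the equation $r_{12}r_{13}+r_{13}r_{23}-r_{23}r_{12}=0$ in $\mathcal{A}\otimes\mathcal{A}\otimes\mathcal{A}$, where $r_{12}r_{13}=\sum_{i,j}x_i\cdot x_j\otimes y_i\otimes y_j$, $r_{13}r_{23}=\sum_{i,j}x_i\otimes x_j\otimes y_i\cdot y_j$, and $r_{23}r_{12}=\sum_{i,j}x_j\otimes x_i\cdot y_j\otimes y_i$. *)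

(* Defs.v *)
From HB Require Import structures.
From mathcomp Require Import all_boot all_order all_algebra.
From mathcomp Require Import sesquilinear.

Set Implicit Arguments.
Unset Strict Implicit.
Unset Printing Implicit Defensive.

Import GRing.Theory.
Local Open Scope ring_scope.

(* Finite-dimensional tensor products, in coordinates over the bases [vbasis];
   [tlift_tens] and [tens_ext] below give the universal property. *)
Section Tensor.
Variable K : fieldType.

Definition tensor (U V : vectType K) : vectType K :=
  'M[K]_(\dim {:U}, \dim {:V}).

Definition tens (U V : vectType K) (u : U) (v : V) : tensor U V :=
  \matrix_(i, j) (coord (vbasis {:U}) i u * coord (vbasis {:V}) j v).

(* The linear map U ⊗ V -> W sending u ⊗ v to f u v, for f bilinear. *)
Definition tlift (U V W : vectType K) (f : U -> V -> W) (r : tensor U V) : W :=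
  \sum_i \sum_j r i j *: f (vbasis {:U})`_i (vbasis {:V})`_j.

End Tensor.

Notation "U ⊗ V" := (tensor U%type V%type)
  (at level 40, left associativity) : type_scope.
Notation "u ⊗ v" := (tens u v)
  (at level 40, left associativity) : ring_scope.

Section TensorTheory.
Variable K : fieldType.
Implicit Types U V W : vectType K.

Lemma tensDl U V (v : V) : {morph (fun u : U => u ⊗ v) : x y / x + y}.
Proof. by move=> x y; apply/matrixP=> i j; rewrite !mxE linearD mulrDl. Qed.

Lemma tensDr U V (u : U) : {morph (fun v : V => u ⊗ v) : x y / x + y}.
Proof. by move=> x y; apply/matrixP=> i j; rewrite !mxE linearD mulrDr. Qed.

Lemma tensZl U V a (u : U) (v : V) : (a *: u) ⊗ v = a *: (u ⊗ v).
Proof. by apply/matrixP=> i j; rewrite !mxE linearZ mulrA. Qed.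

Lemma tensZr U V a (u : U) (v : V) : u ⊗ (a *: v) = a *: (u ⊗ v).
Proof. by apply/matrixP=> i j; rewrite !mxE linearZ mulrCA. Qed.

Fact tens_is_bilinear U V : bilinear_for
  (GRing.Scale.Law.clone _ _ *:%R _) (GRing.Scale.Law.clone _ _ *:%R _)
  (@tens K U V).
Proof.
by split=> z a x y /=; rewrite (tensDl, tensDr) (tensZl, tensZr).
Qed.

HB.instance Definition _ U V := bilinear_isBilinear.Build K U V (U ⊗ V)%type
  _ _ (@tens K U V) (@tens_is_bilinear U V).

Fact tlift_is_linear U V W (f : U -> V -> W) : linear (@tlift K U V W f).
Proof.
move=> a r s; rewrite /tlift scaler_sumr -big_split /=; apply: eq_bigr => i _.
rewrite scaler_sumr -big_split /=; apply: eq_bigr => j _.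
by rewrite !mxE scalerDl scalerA.
Qed.

HB.instance Definition _ U V W (f : U -> V -> W) :=
  GRing.isLinear.Build K (U ⊗ V)%type W *:%R (@tlift K U V W f)
    (@tlift_is_linear U V W f).

Lemma tlift_tens U V W (f : {bilinear U -> V -> W}) u v :
  tlift f (u ⊗ v) = f u v.
Proof.
rewrite {2}(coord_vbasis (memvf u)) {2}(coord_vbasis (memvf v)).
rewrite linear_sumlz; apply: eq_bigr => i _.
rewrite linear_sumr; apply: eq_bigr => j _.
by rewrite mxE linearZl_LR linearZr_LR scalerA.
Qed.

Lemma tens_basis U V (i : 'I_(\dim {:U})) (j : 'I_(\dim {:V})) :
  (vbasis {:U})`_i ⊗ (vbasis {:V})`_j = delta_mx i j :> (U ⊗ V)%type.
Proof.
apply/matrixP=> k l; rewrite !mxE !coord_free ?(basis_free (vbasisP _)) //.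
by rewrite -natrM mulnb (eq_sym k) (eq_sym l).
Qed.

Lemma tens_span U V (r : (U ⊗ V)%type) :
  r = \sum_i \sum_j (r i j *: (vbasis {:U})`_i) ⊗ (vbasis {:V})`_j.
Proof.
rewrite [LHS]matrix_sum_delta; apply: eq_bigr => i _; apply: eq_bigr => j _.
by rewrite tensZl tens_basis.
Qed.

Lemma tens_ext U V W (g h : {linear (U ⊗ V)%type -> W}) :
  (forall u v, g (u ⊗ v) = h (u ⊗ v)) -> g =1 h.
Proof.
move=> gh r; rewrite (tens_span r) !linear_sum; apply: eq_bigr => i _.
by rewrite !linear_sum; apply: eq_bigr => j _; apply: gh.
Qed.

Lemma tlift_sum U V W (f : {bilinear U -> V -> W}) I (s : seq I)
    (x : I -> U) (y : I -> V) :
  tlift f (\sum_(i <- s) x i ⊗ y i) = \sum_(i <- s) f (x i) (y i).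
Proof. by rewrite linear_sum; apply: eq_bigr => i _; apply: tlift_tens. Qed.

End TensorTheory.

Record assocAlg (K : fieldType) := AssocAlg {
  alg_sort :> vectType K;
  amul : {bilinear alg_sort -> alg_sort -> alg_sort};
  amulA : associative amul
}.
Notation "x ⋅ y" := (amul _ x y) (at level 40, left associativity) : ring_scope.

Definition alg_isom (K : fieldType) (A B : assocAlg K) : Prop :=
  exists f : {linear A -> B},
    bijective f /\ forall x y : A, f (x ⋅ y) = f x ⋅ f y.

Section AYBE.
Variables (K : fieldType) (A : assocAlg K).

(* In each definition x, y run over the tensor factors of the first copy of r
   and x', y' over those of the second. *)
Definition r12r13 (r : A ⊗ A) : (A ⊗ A) ⊗ A :=
  tlift (fun x y => tlift (fun x' y' => (x ⋅ x') ⊗ y ⊗ y') r) r.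

Definition r13r23 (r : A ⊗ A) : (A ⊗ A) ⊗ A :=
  tlift (fun x y => tlift (fun x' y' => x ⊗ x' ⊗ (y ⋅ y')) r) r.

Definition r23r12 (r : A ⊗ A) : (A ⊗ A) ⊗ A :=
  tlift (fun x y => tlift (fun x' y' => x' ⊗ (x ⋅ y') ⊗ y) r) r.

Definition AYBE (r : A ⊗ A) : Prop := r12r13 r + r13r23 r - r23r12 r = 0.

Lemma tlift2_sum (W : vectType K) (F : A -> A -> A -> A -> W)
    I (s : seq I) (x y : I -> A) :
    (forall a b, bilinear_for
       (GRing.Scale.Law.clone _ _ *:%R _) (GRing.Scale.Law.clone _ _ *:%R _)
       (F a b)) ->
    (forall a b, bilinear_for
       (GRing.Scale.Law.clone _ _ *:%R _) (GRing.Scale.Law.clone _ _ *:%R _)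
       (fun c d => F c d a b)) ->
  let r := \sum_(i <- s) x i ⊗ y i in
  tlift (fun a b => tlift (F a b) r) r =
    \sum_(i <- s) \sum_(j <- s) F (x i) (y i) (x j) (y j).
Proof.
move=> F1 F2 r.
have inner a b : tlift (F a b) r = \sum_(j <- s) F a b (x j) (y j).
  pose B := bilinear_isBilinear.Build K A A W _ _ (F a b) (F1 a b).
  pose f : {bilinear A -> A -> W} := HB.pack (F a b) B.
  exact: (tlift_sum f).
have bil : bilinear_for
    (GRing.Scale.Law.clone _ _ *:%R _) (GRing.Scale.Law.clone _ _ *:%R _)
    (fun a b => tlift (F a b) r).
  split=> z c u v /=; rewrite !inner scaler_sumr -big_split /=;
    apply: eq_bigr => j _; have [l1 l2] := F2 (x j) (y j).
    exact: l1.
  exact: l2.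
pose B := bilinear_isBilinear.Build K A A W _ _ _ bil.
pose f : {bilinear A -> A -> W} := HB.pack (fun a b => tlift (F a b) r) B.
rewrite -[LHS]/(tlift f r) tlift_sum; apply: eq_bigr => i _; exact: inner.
Qed.

Lemma r12r13E I (s : seq I) (x y : I -> A) :
  r12r13 (\sum_(i <- s) x i ⊗ y i) =
    \sum_(i <- s) \sum_(j <- s) (x i ⋅ x j) ⊗ y i ⊗ y j.
Proof.
apply: (tlift2_sum (F := fun x y x' y' => (x ⋅ x') ⊗ y ⊗ y')) => a b;
  split=> z c u v /=;
  by rewrite ?(linearPl, linearPr).
Qed.

Lemma r13r23E I (s : seq I) (x y : I -> A) :
  r13r23 (\sum_(i <- s) x i ⊗ y i) =
    \sum_(i <- s) \sum_(j <- s) x i ⊗ x j ⊗ (y i ⋅ y j).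
Proof.
apply: (tlift2_sum (F := fun x y x' y' => x ⊗ x' ⊗ (y ⋅ y'))) => a b;
  split=> z c u v /=;
  by rewrite ?(linearPl, linearPr).
Qed.

Lemma r23r12E I (s : seq I) (x y : I -> A) :
  r23r12 (\sum_(i <- s) x i ⊗ y i) =
    \sum_(i <- s) \sum_(j <- s) x j ⊗ (x i ⋅ y j) ⊗ y i.
Proof.
apply: (tlift2_sum (F := fun x y x' y' => x' ⊗ (x ⋅ y') ⊗ y)) => a b;
  split=> z c u v /=;
  by rewrite ?(linearPl, linearPr).
Qed.

End AYBE.

(* Both algebras live on K^o, the vector space K over itself, with e1 = 1. *)
Section OneDim.
Variable K : fieldType.

Definition mul1 (x y : K^o) : K^o := 0.
Definition mul2 (x y : K^o) : K^o := x * y.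

Fact mul1_is_bilinear : bilinear_for
  (GRing.Scale.Law.clone _ _ *:%R _) (GRing.Scale.Law.clone _ _ *:%R _) mul1.
Proof. by split=> z a x y; rewrite /mul1 /= scaler0 addr0. Qed.

Fact mul2_is_bilinear : bilinear_for
  (GRing.Scale.Law.clone _ _ *:%R _) (GRing.Scale.Law.clone _ _ *:%R _) mul2.
Proof.
split=> z a x y; rewrite /mul2 /=; first by rewrite mulrDl scalerAl.
by rewrite mulrDr scalerAr.
Qed.

HB.instance Definition _ :=
  bilinear_isBilinear.Build K K^o K^o K^o _ _ mul1 mul1_is_bilinear.
HB.instance Definition _ :=
  bilinear_isBilinear.Build K K^o K^o K^o _ _ mul2 mul2_is_bilinear.

Definition alg1 : assocAlg K := @AssocAlg K K^o mul1 (fun _ _ _ => erefl).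
Definition alg2 : assocAlg K := @AssocAlg K K^o mul2 (@mulrA K).

Definition e1_alg1 : alg1 := (1 : K^o).
Definition e1_alg2 : alg2 := (1 : K^o).

End OneDim.

(* Main.v *)
Require Import Defs.
From HB Require Import structures.
From mathcomp Require Import all_boot all_order all_algebra.
From mathcomp Require Import complex reals.

(** A one-dimensional algebra is determined by the scalar [c] such that
    [e ⋅ e = c e] for a generator [e].  Two such algebras with the same scalar
    are isomorphic by sending generator to generator ([line_alg_isom]), and
    replacing [e] by [e / c] turns any nonzero [c] into 1, so only [c = 0] and
    [c = 1] remain; these differ because the first product vanishes identically.

    The tensor square of the line is spanned by [e ⊗ e], so a candidate
    solution is [r = a (e ⊗ e)].  Each of the three quadratic terms of the
    associative Yang-Baxter equation evaluates to [a ^ 2 c (e ⊗ e ⊗ e)]; since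
    two come with a plus sign and one with a minus sign, exactly one copy
    survives ([AYBE_line]).  The equation is therefore [a ^ 2 c = 0]: it
    holds for every [a] if [c = 0] and forces [a = 0] if [c = 1]. *)

Set Implicit Arguments.
Unset Strict Implicit.

Import GRing.Theory.
Local Open Scope ring_scope.

Section Line.
Variable K : fieldType.
Implicit Types (U V : vectType K) (A B : assocAlg K).

Lemma line_basis V (e : V) :
  \dim {:V} = 1%N -> e != 0 -> basis_of {:V} [:: e].
Proof.
move=> dimV e0; rewrite basisEfree subvf dimV leqnn.
by rewrite seq1_free e0.
Qed.

Lemma line_scale V (e : V) :
  basis_of {:V} [:: e] -> forall v, exists k, v = k *: e.
Proof.
move=> /span_basis; rewrite span_seq1 => spanV v.
by apply/vlineP; rewrite spanV memvf.
Qed.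

Lemma line_neq0 V (e : V) : basis_of {:V} [:: e] -> e != 0.
Proof. by move=> /basis_free; rewrite seq1_free. Qed.

Lemma tens_neq0 U V (u : U) (v : V) : u != 0 -> v != 0 -> u ⊗ v != 0.
Proof.
(* A nonzero vector has a nonzero coordinate, and the product of two such
   coordinates is an entry of [u ⊗ v]. *)
have coord_neq0 (W : vectType K) (w : W) :
    w != 0 -> exists i, coord (vbasis {:W}) i w != 0.
  move=> w0; apply/existsP; apply: contraNT w0 => /existsPn w0.
  rewrite (coord_vbasis (memvf w)) big1 // => i _.
  by rewrite (eqP (negbNE (w0 i))) scale0r.
move=> /coord_neq0[i ui] /coord_neq0[j vj].
apply: contraNneq (mulf_neq0 ui vj) => /matrixP/(_ i j).
by rewrite !mxE => ->.
Qed.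

Lemma tensor_line V (e : V) (r : V ⊗ V) :
  basis_of {:V} [:: e] -> exists a, r = a *: (e ⊗ e).
Proof.
move=> be; rewrite (tens_span r).
pose P (s : V ⊗ V) := exists a, s = a *: (e ⊗ e).
have P0 : P 0 by exists 0; rewrite scale0r.
have PD s t : P s -> P t -> P (s + t).
  by move=> [a ->] [b ->]; exists (a + b); rewrite scalerDl.
apply: (big_ind P) => // i _; apply: (big_ind P) => // j _.
have [k ->] := line_scale be (vbasis {:V})`_i.
have [l ->] := line_scale be (vbasis {:V})`_j.
by exists (r i j * k * l); rewrite scalerA tensZl tensZr scalerA.
Qed.

(** Each quadratic term multiplies two copies of [e] in one slot and leaves [e]
    in the other two, so all three equal [a ^ 2 c (e ⊗ e ⊗ e)] and cancel down
    to one copy, which is zero only if its coefficient is. *)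
Lemma AYBE_line A (e : A) (a c : K) :
  e != 0 -> e ⋅ e = c *: e ->
  AYBE (a *: (e ⊗ e)) <-> a ^+ 2 * c = 0.
Proof.
move=> e0 ee.
(* A one-term sum of pure tensors, the shape on which the three products are
   computed. *)
have -> : a *: (e ⊗ e) = \sum_(i <- [:: tt]) (a *: e) ⊗ e.
  by rewrite big_seq1 tensZl.
rewrite /AYBE r12r13E r13r23E r23r12E !big_seq1.
rewrite !(linearZl_LR, linearZr_LR) /= ee.
rewrite !(linearZl_LR, linearZr_LR) /= !scalerA addrK -expr2.
split=> [/eqP|->]; last by rewrite scale0r.
by rewrite scaler_eq0 (negbTE (tens_neq0 (tens_neq0 e0 e0) e0))
  orbF => /eqP.
Qed.

(** The linear map sending [e] to [f] respects products because it does so on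
    the single product [e ⋅ e], which has the same coefficient on both sides. *)
Lemma line_alg_isom A B (e : A) (f : B) (c : K) :
  basis_of {:A} [:: e] -> basis_of {:B} [:: f] ->
  e ⋅ e = c *: e -> f ⋅ f = c *: f -> alg_isom A B.
Proof.
move=> be bf ee ff.
have coordK (V : vectType K) (v : V) k :
    basis_of {:V} [:: v] -> coord [tuple v] ord0 (k *: v) = k.
  move=> bv; rewrite linearZ /= -[v in coord _ _ v]/([tuple v]`_(@ord0 0)).
  by rewrite coord_free ?(basis_free bv) // eqxx mulr1.
pose g (x : A) : B := coord [tuple e] ord0 x *: f.
have g_lin : linear g by move=> a x y; rewrite /g linearP scalerDl scalerA.
pose gL : {linear A -> B} := HB.pack g (GRing.isLinear.Build K A B *:%R g g_lin).
have gE k : gL (k *: e) = k *: f by rewrite /= /g coordK.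
exists gL; split.
  exists (fun y => coord [tuple f] ord0 y *: e) => [x|y].
    by have [k ->] := line_scale be x; rewrite gE coordK.
  by have [k ->] := line_scale bf y; rewrite coordK // gE.
move=> x y; have [k ->] := line_scale be x; have [l ->] := line_scale be y.
rewrite !gE !(linearZl_LR, linearZr_LR) /= ee ff.
by rewrite !scalerA; apply: gE.
Qed.

Lemma e1_alg1_basis : basis_of {:alg1 K} [:: e1_alg1 K].
Proof. by apply: line_basis; [rewrite dimvf | apply: oner_neq0]. Qed.

Lemma e1_alg2_basis : basis_of {:alg2 K} [:: e1_alg2 K].
Proof. by apply: line_basis; [rewrite dimvf | apply: oner_neq0]. Qed.

Lemma e1_alg2_idem : e1_alg2 K ⋅ e1_alg2 K = e1_alg2 K.
Proof. exact: mulr1. Qed.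

Lemma line_alg_classification A :
  \dim {:A} = 1%N -> alg_isom A (alg1 K) \/ alg_isom A (alg2 K).
Proof.
move=> dimA; pose e := vpick {:A}.
have e0 : e != 0 by rewrite vpick0 -dimv_eq0 dimA.
have be := line_basis dimA e0.
have [c ee] := line_scale be (e ⋅ e).
have [c0|c0] := eqVneq c 0; [left|right].
  by apply: (line_alg_isom (c := 0) be e1_alg1_basis); rewrite -?c0 // c0 scale0r.
(* [(e / c) ⋅ (e / c) = c e / c ^ 2 = e / c], so [e / c] is idempotent. *)
have be' : basis_of {:A} [:: c^-1 *: e].
  by apply: line_basis; rewrite // scaler_eq0 invr_eq0 negb_or c0.
apply: (line_alg_isom (c := 1) be' e1_alg2_basis); rewrite scale1r.
  rewrite !(linearZl_LR, linearZr_LR) /= ee !scalerA.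
  by rewrite mulfVK.
exact: e1_alg2_idem.
Qed.

(** The preimage of the idempotent generator would be a nonzero idempotent, but all
    products in [alg1] vanish. *)
Lemma alg1_alg2_nisom : ~ alg_isom (alg1 K) (alg2 K).
Proof.
case=> g [[h hK gK] gM]; have := gM (h (e1_alg2 K)) (h (e1_alg2 K)).
rewrite gK e1_alg2_idem => /esym /eqP.
have -> : h (e1_alg2 K) ⋅ h (e1_alg2 K) = 0 by [].
by rewrite linear0 (negbTE (line_neq0 e1_alg2_basis)).
Qed.

End Line.

Theorem proposition3p1 (R : realType) :
  let C : fieldType := R[i] in
  let A1 : assocAlg C := alg1 C in
  let A2 : assocAlg C := alg2 C in
  let e1 : A1 := e1_alg1 C in
  let e2 : A2 := e1_alg2 C in
  [/\ basis_of {:A1} [:: e1] /\ e1 ⋅ e1 = 0,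
      basis_of {:A2} [:: e2] /\ e2 ⋅ e2 = e2,
      forall A : assocAlg C, \dim {:A} = 1%N ->
        alg_isom A A1 \/ alg_isom A A2
    & ~ alg_isom A1 A2]
  /\ (forall r : A1 ⊗ A1,
        AYBE r <-> exists a11 : C, r = a11 *: (e1 ⊗ e1))
  /\ (forall r : A2 ⊗ A2, AYBE r <-> r = 0).
Proof.
move=> C A1 A2 e1 e2.
have b1 : basis_of {:A1} [:: e1] := e1_alg1_basis C.
have b2 : basis_of {:A2} [:: e2] := e1_alg2_basis C.
split; [split|split=> r].
- by split.
- by split; [|apply: e1_alg2_idem].
- exact: line_alg_classification.
- exact: alg1_alg2_nisom.
- split=> [_|[a ->]]; first exact: tensor_line.
  have e11 : e1 ⋅ e1 = 0 *: e1 by rewrite scale0r.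
  by apply/(AYBE_line a (line_neq0 b1) e11); rewrite mulr0.
have e22 : e2 ⋅ e2 = 1 *: e2 by rewrite scale1r; apply: e1_alg2_idem.
have AYBE2 a := AYBE_line a (line_neq0 b2) e22.
split=> [|->].
  have [a ->] := tensor_line r b2.
  by move=> /AYBE2/eqP; rewrite mulr1 expf_eq0 => /eqP->; rewrite scale0r.
by rewrite -(scale0r (e2 ⊗ e2)); apply/AYBE2; rewrite expr0n mul0r.
Qed.
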